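(* Let $N\ge 1$ and $s\ge 1$ be integers. Then a generic tensor $t\in \mathrm{TNS}'(\widetilde G_{2\times N}, s^2,s^2,s^2)$ has edge/vertex flattening $$\big((\mathbb{C}^{s^2})^{\otimes (2N+4)}\big)^{*}\longrightarrow (\mathbb{C}^{s^2})^{\otimes 2N}$$ of full rank (that is, of rank equal to the minimum of the dimensions of its source and target).
   Context: The graph $\widetilde G_{2\times N}$ (the $2\times N$ grid not on a torus) has $2N$ vertices arranged in 2 rows and $N$ columns: upper vertices $1,\dots,N$ and lower vertices $1',\dots,N'$. Every vertex is incident to exactly five edges: an up edge, a right edge, a down edge, a left edge, and one ''vertex'' dangling edge (a dangling edge is an edge attached to only one vertex). For $1\le p\le N-1$, the right edge of $p$ is the left edge of $p+1$, and the right edge of $p'$ is the left edge of $(p+1)'$; for $1\le p\le N$, the down edge of $p$ is the up edge of $p'$. These shared edges are the entanglement edges. All other up/right/down/left edges (the up edges of $1,\dots,N$, the down edges of $1',\dots,N'$, the left edges of $1,1'$ and the right edges of $N,N'$) are dangling; these $2N+4$ edges are called external physical edges. The $2N$ vertex dangling edges are the non-external physical edges. In total there are $4N+4$ physical (dangling) edges. Bound tensor network state: the parameters in $\mathrm{TNS}'(\widetilde G_{2\times N},d,k,s_0)$ are the dimensions of the spaces attached to entanglement edges ($d$), non-external physical edges ($k$) and external physical edges ($s_0$), respectively. When $s_0=d$, put $\mathbf V=\mathbb{C}^k\otimes U\otimes R\otimes D\otimes L$, where $\mathbb{C}^k$ belongs to the vertex dangling edge, $U=L=\mathbb{C}^d$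 belong to the up and left edges, and $R=D=(\mathbb{C}^d)^*$ belong to the right and down edges. For $T\in\mathbf V$, place a copy of the same tensor $T$ at each of the $2N$ vertices, take the tensor product of all copies, and for each entanglement edge contract the two corresponding factors (the $R$ factor of the left vertex with the $L$ factor of the right vertex for horizontal edges; the $D$ factor of the upper vertex with the $U$ factor of the lower vertex for vertical edges) using the natural pairing of $(\mathbb{C}^d)^*$ with $\mathbb{C}^d$. The result $\phi(T)$ is a tensor in the tensor product of the spaces of all $4N+4$ physical edges (the spaces of external physical edges being copies of $\mathbb{C}^d$, with $(\mathbb{C}^d)^*$ identified with $\mathbb{C}^d$ by the standard basis). Then $\mathrm{TNS}'(\widetilde G_{2\times N},d,k,d)=\{\phi(T): T\in\mathbf V\}$. Edge/vertex flattening: a tensor $t\in X\otimes Y$, where $X$ is the tensor product of the spaces of the $2N+4$ external physical edges and $Y$ is the tensor product of the spaces of the $2N$ non-external physical edges, is regarded as a linear map $X^*\to Y$. Generic: a property holds for a generic $t\in\mathrm{TNS}'$ if it holds for $\phi(T)$ for all $T$ in some nonempty Zariski open subset of the complex vector space $\mathbf V$. *)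

(* Defs.v *)
From mathcomp Require Import all_boot all_order all_algebra.
From mathcomp Require Import mpoly.

Set Implicit Arguments.
Unset Strict Implicit.
Unset Printing Implicit Defensive.

Import GRing.Theory.
Local Open Scope ring_scope.

(* (r, p) is the vertex in row r (0 = upper row, 1 = lower row) and column p. *)
Definition vertex (N : nat) : finType := ('I_2 * 'I_N)%type.

(* All edges of the 2 x N grid other than the vertex dangling edges.
   inl (r, q), q <= N, is the horizontal edge of row r joining columns q - 1
   and q; it dangles for q = 0 and q = N.
   inr (q, p), q <= 2, is the vertical edge of column p joining rows q - 1
   and q; it dangles for q = 0 and q = 2. *)
Definition edge (N : nat) : finType := ('I_2 * 'I_N.+1 + 'I_3 * 'I_N)%type.

Definition left_edge (N : nat) (v : vertex N) : edge N :=
  inl (v.1, widen_ord (leqnSn N) v.2).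
Definition right_edge (N : nat) (v : vertex N) : edge N :=
  inl (v.1, lift ord0 v.2).
Definition up_edge (N : nat) (v : vertex N) : edge N :=
  inr (widen_ord (leqnSn 2) v.1, v.2).
Definition down_edge (N : nat) (v : vertex N) : edge N :=
  inr (lift ord0 v.1, v.2).

Definition incident (N : nat) (e : edge N) (v : vertex N) : bool :=
  e \in [:: up_edge v; right_edge v; down_edge v; left_edge v].

Definition dangling (N : nat) (e : edge N) : bool :=
  #|[set v | incident e v]| == 1%N.

(* The external physical edges; the other edges in [edge N] are the
   entanglement edges. *)
Definition ext_edge (N : nat) : finType := {e : edge N | dangling e}.

(* Indices of the standard bases of X and Y. *)
Definition ext_index (N d : nat) : finType := {ffun ext_edge N -> 'I_d}.
Definition vtx_index (N k : nat) : finType := {ffun vertex N -> 'I_k}.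

(* V = C^k (x) U (x) R (x) D (x) L, in coordinates (factors in this order). *)
Definition site_index (d k : nat) : finType :=
  ('I_k * 'I_d * 'I_d * 'I_d * 'I_d)%type.
Definition site_tensor (C : fieldType) (d k : nat) : Type :=
  {ffun site_index d k -> C}.

(* X (x) Y, in coordinates. *)
Definition state (C : fieldType) (N d k : nat) : Type :=
  {ffun ext_index N d * vtx_index N k -> C}.

(* phi(T): the pairing of (C^d)^* with C^d on an entanglement edge forces the
   two indices on that edge to agree and sums over their common value.  So the
   (x, y) coordinate is a sum over the labelings of all edges that extend x. *)
Definition contraction (C : fieldType) (N d k : nat)
    (T : site_tensor C d k) : state C N d k :=
  [ffun xy : ext_index N d * vtx_index N k =>
    \sum_(a : {ffun edge N -> 'I_d} |
            [forall e : ext_edge N, a (val e) == xy.1 e])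
      \prod_(v : vertex N)
        T (xy.2 v, a (up_edge v), a (right_edge v),
           a (down_edge v), a (left_edge v))].

Definition zariski_open (C : fieldType) (I : finType)
    (U : {ffun I -> C} -> Prop) : Prop :=
  exists S : {mpoly C[#|I|]} -> Prop,
    forall T : {ffun I -> C},
      U T <->
      exists2 p, S p & p.@[fun i : 'I_#|I| => T (enum_val i)] != 0.

(* "P holds for a generic t in TNS'(G~_{2 x N}, d, k, d)". *)
Definition generic_TNS (C : fieldType) (N d k : nat)
    (P : state C N d k -> Prop) : Prop :=
  exists U : site_tensor C d k -> Prop,
    [/\ zariski_open U, exists T, U T
      & forall T, U T -> P (contraction N T)].

(* The map X^* -> Y, as a matrix acting on row vectors. *)
Definition flattening (C : fieldType) (N d k : nat) (t : state C N d k) :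
    'M[C]_(#|ext_index N d|, #|vtx_index N k|) :=
  \matrix_(i, j) t (enum_val i, enum_val j).

(* Main.v *)
Require Import Defs.
From mathcomp Require Import all_boot all_order all_algebra.
From mathcomp Require Import mpoly.
From mathcomp Require Import reals complex.

(** The flattening has at least as many rows as columns, so full rank means
    that some maximal minor is nonzero.  Each minor is a polynomial in the
    entries of the site tensor [T] ([meval_minor_poly]), hence the condition is
    Zariski open, and a single [T] with a nonzero maximal minor suffices
    ([generic_full_col_rank]).

    Such a [T] is found by writing C^(s^2) = C^s (x) C^s, so that an index [i]
    becomes a pair (i1, i2).  The tensor [routing_tensor] has entry 1 when its
    vertex, up and down indices [y], [u], [e] satisfy

      y1 = u1,   y2 = e2,   u2 = e1,

    and its two horizontal indices take one fixed value; all its other entries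
    are 0.  So each vertex sends half of its index upwards and half downwards
    and passes a third half-index straight through.  In one column, with upper
    vertex index y and lower vertex index z, the labels of the three vertical
    edges are then forced to be

      (y1, z1),   (z1, y2),   (y2, z2)

    from top to bottom.  Thus the vertex indices determine the whole edge
    labeling ([routing_labelingP]), and conversely they can be read off the two
    outer edges of every column ([boundary_inj]).  The flattening of the
    resulting state is a 0/1 matrix, whose rows at the boundary values form an
    identity matrix. *)

Set Implicit Arguments.
Unset Strict Implicit.
Unset Printing Implicit Defensive.

Import GRing.Theory.
Local Open Scope ring_scope.

Lemma mxrank_rowsub_unit (C : fieldType) (m n : nat) (f : 'I_n -> 'I_m)
    (A : 'M[C]_(m, n)) :
  \det (rowsub f A) != 0 -> \rank A = n.
Proof.
move=> detN0; apply/eqP; rewrite eqn_leq rank_leq_col /=.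
have /mxrank_unit {1}<- : rowsub f A \in unitmx by rewrite unitmxE unitfE.
by rewrite -[A in rowsub f A]mul1mx -mul_rowsub_mx mxrankM_maxr.
Qed.

Section Genericity.
Variables (C : fieldType) (N d k : nat).

Definition contraction_poly (xy : ext_index N d * vtx_index N k) :
    {mpoly C[#|site_index d k|]} :=
  \sum_(a : {ffun edge N -> 'I_d} |
          [forall e : ext_edge N, a (val e) == xy.1 e])
    \prod_(v : vertex N)
      'X_(enum_rank (xy.2 v, a (up_edge v), a (right_edge v),
                     a (down_edge v), a (left_edge v))).

Definition minor_poly (f : 'I_#|vtx_index N k| -> 'I_#|ext_index N d|) :
    {mpoly C[#|site_index d k|]} :=
  \det (\matrix_(i, j) contraction_poly (enum_val (f i), enum_val j)).

Lemma meval_contraction_poly (T : site_tensor C d k) xy :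
  (contraction_poly xy).@[fun i => T (enum_val i)] = contraction N T xy.
Proof.
rewrite /contraction_poly ffunE rmorph_sum; apply: eq_bigr => a _.
rewrite /= rmorph_prod; apply: eq_bigr => v _.
by rewrite /= mevalXU enum_rankK.
Qed.

Lemma meval_minor_poly (T : site_tensor C d k) f :
  (minor_poly f).@[fun i => T (enum_val i)] =
  \det (rowsub f (flattening (contraction N T))).
Proof.
rewrite /minor_poly -det_map_mx; congr (\det _); apply/matrixP => i j.
by rewrite !mxE; exact: meval_contraction_poly.
Qed.

Lemma generic_full_col_rank (T0 : site_tensor C d k)
    (f : 'I_#|vtx_index N k| -> 'I_#|ext_index N d|) :
  \det (rowsub f (flattening (contraction N T0))) != 0 ->
  @generic_TNS C N d k (fun t => \rank (flattening t) = #|vtx_index N k|).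
Proof.
move=> detN0.
exists (fun T => (minor_poly f).@[fun i => T (enum_val i)] != 0).
split=> [|| T]; last by rewrite meval_minor_poly; exact: mxrank_rowsub_unit.
- exists (eq (minor_poly f)) => T.
  by split=> [pN0|[p <-//]]; exists (minor_poly f).
- by exists T0; rewrite meval_minor_poly.
Qed.

End Genericity.

Definition row0 : 'I_2 := ord0.
Definition row1 : 'I_2 := lift ord0 ord0.

Lemma row_cases (r : 'I_2) : r = row0 \/ r = row1.
Proof. by case: r => [[|[|//]] ?]; [left|right]; apply: val_inj. Qed.

Lemma dangling_top (N : nat) (p : 'I_N) : dangling (up_edge (row0, p)).
Proof.
apply/cards1P; exists (row0, p); apply/setP => -[r q].
rewrite !inE /incident !inE /= orbF.
by case: (row_cases r) => ->;
  rewrite /eq_op /= /eq_op /= /eq_op /= ?orbF ?andbF // eq_sym.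
Qed.

Lemma dangling_bottom (N : nat) (p : 'I_N) : dangling (down_edge (row1, p)).
Proof.
apply/cards1P; exists (row1, p); apply/setP => -[r q].
rewrite !inE /incident !inE /= orbF.
by case: (row_cases r) => ->;
  rewrite /eq_op /= /eq_op /= /eq_op /= ?orbF ?andbF // eq_sym.
Qed.

(** The vertical edges are listed from top to bottom, the middle one as the up
    edge of the lower vertex.  Each horizontal edge is adjacent to some vertex
    because there is at least one column. *)
Lemma edge_cases (N : nat) (Q : edge N -> Prop) :
  (0 < N)%N ->
  (forall v, Q (left_edge v)) -> (forall v, Q (right_edge v)) ->
  (forall p, Q (up_edge (row0, p))) -> (forall p, Q (up_edge (row1, p))) ->
  (forall p, Q (down_edge (row1, p))) -> forall e, Q e.
Proof.
move=> N_gt0 Ql Qr Q0 Q1 Q2 [[r q]|[q p]].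
  case: (unliftP ord0 q) => [j ->|->]; first exact: (Qr (r, j)).
  have -> : ord0 = widen_ord (leqnSn N) (Ordinal N_gt0) by exact: val_inj.
  exact: (Ql (r, Ordinal N_gt0)).
case: q => [[|[|[|//]]] lt_q3].
- by have := Q0 p; congr (Q (inr (_, _))); exact: val_inj.
- by have := Q1 p; congr (Q (inr (_, _))); exact: val_inj.
- by have := Q2 p; congr (Q (inr (_, _))); exact: val_inj.
Qed.

Section Routing.
Variables (C : fieldType) (N d : nat) (A : finType).
(** [split] and [merge] encode C^d = C^A (x) C^A; [o] is the value imposed on
    the horizontal edges. *)
Variables (split : 'I_d -> A * A) (merge : A * A -> 'I_d) (o : 'I_d).
Hypotheses (splitK : cancel split merge) (mergeK : cancel merge split).
Hypothesis N_gt0 : (0 < N)%N.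

Definition routed (i : site_index d d) : bool :=
  let: (y, u, r, e, l) := i in
  [&& (split y).1 == (split u).1, (split y).2 == (split e).2,
      (split u).2 == (split e).1, r == o & l == o].

Definition routing_tensor : site_tensor C d d := [ffun i => (routed i)%:R].

Definition routing_labeling (y : vtx_index N d) : {ffun edge N -> 'I_d} :=
  [ffun e : edge N => match e with
   | inl _ => o
   | inr (q, p) =>
     let y0 := split (y (row0, p)) in let y1 := split (y (row1, p)) in
     match val q with
     | 0 => merge (y0.1, y1.1)
     | 1 => merge (y1.1, y0.2)
     | _ => merge (y0.2, y1.2)
     end
   end].

Definition boundary (y : vtx_index N d) : ext_index N d :=
  [ffun e => routing_labeling y (val e)].

Definition site_at (y : vtx_index N d) (a : {ffun edge N -> 'I_d})
    (v : vertex N) : site_index d d :=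
  (y v, a (up_edge v), a (right_edge v), a (down_edge v), a (left_edge v)).

(** Of the six half-indices on the vertical edges of a column, the vertex
    indices fix four directly; the equations u2 = e1 of the two vertices fix
    the other two. *)
Lemma routing_labelingP y a :
  [forall v, routed (site_at y a v)] = (a == routing_labeling y).
Proof.
have split_inj := can_inj splitK.
have mid p : down_edge (row0, p) = up_edge (row1, p) :> edge N.
  by congr (inr (_, _)); exact: val_inj.
apply/forallP/eqP => [ok|-> [r p]]; last first.
  by case: (row_cases r) => ->; rewrite /routed /= !ffunE /= !mergeK /= !eqxx.
apply/ffunP; apply: edge_cases => // [v|v|p|p|p].
- by rewrite ffunE; case/and5P: (ok v) => _ _ _ _ /eqP.
- by rewrite ffunE; case/and5P: (ok v) => _ _ _ /eqP.
all: have /and5P[/eqP y01 /eqP y02 /eqP thru0 _ _] := ok (row0, p).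
all: have /and5P[/eqP y11 /eqP y12 /eqP thru1 _ _] := ok (row1, p).
all: rewrite mid in y02 thru0.
all: apply: split_inj; rewrite ffunE /= mergeK.
- by rewrite y01 y11 -thru0 -surjective_pairing.
- by rewrite y11 y02 -surjective_pairing.
- by rewrite y02 y12 thru1 -surjective_pairing.
Qed.

(** The outer edges (y1, z1) and (y2, z2) of a column contain the four
    half-indices of its two vertices. *)
Lemma boundary_inj : injective boundary.
Proof.
move=> y z /ffunP eq_yz; apply/ffunP => -[r p].
have := eq_yz (Sub _ (dangling_top p)).
have := eq_yz (Sub _ (dangling_bottom p)).
rewrite !ffunE /= => /(can_inj mergeK)[eq02 eq12] /(can_inj mergeK)[eq01 eq11].
apply: (can_inj splitK).
rewrite [LHS]surjective_pairing [RHS]surjective_pairing.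
by case: (row_cases r) => ->; congr (_, _).
Qed.

(** Only the labeling forced by [y] has a nonzero weight, so the sum is 1 or 0
    according to whether [x] is the restriction of that labeling. *)
Lemma contraction_routing x y :
  contraction N routing_tensor (x, y) = (x == boundary y)%:R.
Proof.
have weight a : \prod_v routing_tensor (site_at y a v)
                = (a == routing_labeling y)%:R.
  rewrite -routing_labelingP; case: forallP => [ok|/forallP].
    by apply: big1 => v _; rewrite ffunE ok.
  rewrite negb_forall => /existsP[v /negbTE bad].
  by rewrite (bigD1 v) //= ffunE bad mul0r.
rewrite ffunE /= big_mkcond (bigD1 (routing_labeling y)) //= weight eqxx.
rewrite big1 => [|a /negbTE neq]; last by rewrite weight neq if_same.
rewrite addr0 (_ : [forall e, _] = (x == boundary y)); first by case: eqP.
apply/forallP/eqP => [ext|-> e]; last by rewrite [boundary y e]ffunE.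
by apply/ffunP => e; rewrite [boundary y e]ffunE (eqP (ext e)).
Qed.

Definition boundary_row (j : 'I_#|vtx_index N d|) : 'I_#|ext_index N d| :=
  enum_rank (boundary (enum_val j)).

Lemma rowsub_flattening_routing :
  rowsub boundary_row (flattening (contraction N routing_tensor)) = 1%:M.
Proof.
apply/matrixP => i j; rewrite !mxE enum_rankK contraction_routing.
by rewrite (inj_eq boundary_inj) (inj_eq enum_val_inj).
Qed.

End Routing.

Theorem theorem1p4 (R : realType) (N s : nat) (hN : (1 <= N)%N)
    (hs : (1 <= s)%N) :
  @generic_TNS R[i] N (s ^ 2) (s ^ 2)
    (fun t : state R[i] N (s ^ 2) (s ^ 2) =>
       \rank (flattening t) =
         minn ((s ^ 2) ^ (2 * N + 4)) ((s ^ 2) ^ (2 * N))).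
Proof.
have d_gt0 : (0 < s ^ 2)%N by rewrite expn_gt0 hs.
have cardA : (s ^ 2)%N = #|{: 'I_s * 'I_s}| by rewrite card_prod card_ord.
have -> : minn ((s ^ 2) ^ (2 * N + 4)) ((s ^ 2) ^ (2 * N))
          = #|vtx_index N (s ^ 2)|.
  rewrite card_ffun card_prod !card_ord; apply/minn_idPr.
  by rewrite leq_pexp2l ?leq_addr.
pose split (i : 'I_(s ^ 2)) := enum_val (cast_ord cardA i).
pose merge p : 'I_(s ^ 2) := cast_ord (esym cardA) (enum_rank p).
have splitK : cancel split merge.
  by move=> i; rewrite /merge enum_valK cast_ordK.
have mergeK : cancel merge split.
  by move=> p; rewrite /split cast_ordKV enum_rankK.
pose o := Ordinal d_gt0.
apply: (@generic_full_col_rank _ _ _ _ (routing_tensor _ split o)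
          (boundary_row split merge o)).
by rewrite rowsub_flattening_routing // det1 oner_neq0.
Qed.
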